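(* Consider the linear quadratic Gaussian (LQG) setting described in the context, and let $g\in\mathbb R^n$, $h>0$, $\epsilon\in(0,1)$. Given a policy $\pi$, let $\mu$ be the resulting discounted occupation measure, with finite second moments, and let $Z_{xx}=\int xx^T\,\mu(dx,\mathbb R^m)$. Put $Q_1=gg^T$. (1) With $\beta_1=\epsilon h^2$, $$\operatorname{Tr}(Q_1Z_{xx})\le\beta_1\ \Longrightarrow\ \sum_{t=0}^\infty\alpha^t\,\mathbb P^\pi_{\nu_0}\big(|g^Tx_t|\le h\big)\ge1-\epsilon.$$ (2) Furthermore, if $\pi$ is the deterministic linear policy $\pi(x)=Kx$ for some $K\in\mathbb R^{m\times n}$, then with $$\beta_1=\frac{h^2}{2\big(\operatorname{erf}^{-1}(1-\epsilon/\bar m)\big)^2},\qquad \bar m=\frac1{1-\alpha},$$ where $\operatorname{erf}$ is the error function, the constraint $\operatorname{Tr}(Q_1Z_{xx})\le\beta_1$ is also sufficient for the chance constraint $\sum_{t=0}^\infty\alpha^t\,\mathbb P^\pi_{\nu_0}(|g^Tx_t|\le h)\ge1-\epsilon$.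
   Context: LQG setting. $x_{t+1}=Ax_t+Bu_t+\omega_t$ with $x_t\in\mathbb R^n$, $u_t\in\mathbb R^m$, and $\omega_t$ i.i.d. Gaussian with mean $0$ and covariance $W$. The initial state $x_0$ is independent of the noise and has a distribution $\nu_0$ with mean $m_0=0$ and finite covariance $\Sigma_0$. The discount factor is $\alpha\in(0,1)$ and the running cost is $x^TQ_0x+u^TR_0u$, where $Q_0=C^TC$ is symmetric positive semidefinite and $R_0$ is symmetric positive definite; the pair $(A,B)$ is controllable and the pair $(A,C)$ is observable. A policy $\pi$ is a (possibly randomized) stationary policy: a stochastic kernel assigning to each $x\in\mathbb R^n$ a probability distribution on $\mathbb R^m$ from which $u_t$ is drawn when $x_t=x$. $\mathbb P^\pi_{\nu_0}$ is the probability law of $(x_t,u_t)_{t\ge0}$ induced by $\nu_0$, $\pi$ and the dynamics. The discounted occupation measure of $\pi$ is $\mu(E\times F)=\sum_{t=0}^\infty\alpha^t\,\mathbb P^\pi_{\nu_0}\{x_t\in E,\ u_t\in F\}$ for Borel $E\subseteq\mathbb R^n$, $F\subseteq\mathbb R^m$; its total mass is $\bar m=1/(1-\alpha)$. $\operatorname{erf}(z)=\frac{2}{\sqrt\pi}\int_0^z e^{-s^2}ds$ (here $\pi$ is the number, not the policy).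
   Formalization: In part (2) the initial distribution ν₀ is additionally assumed to be Gaussian (mean 0, covariance Σ₀, possibly degenerate); for general ν₀ with finite covariance part (2) is false, e.g. for a three-point distribution of x₀ with A=0, K=0, W=0. *)

(* Defs.v *)
From HB Require Import structures.
From mathcomp Require Import all_boot all_order all_algebra.
From mathcomp Require Import all_classical all_reals all_analysis.

Set Implicit Arguments.
Unset Strict Implicit.
Unset Printing Implicit Defensive.

Import Order.TTheory GRing.Theory Num.Theory.
Import numFieldNormedType.Exports.

Local Open Scope classical_set_scope.
Local Open Scope ring_scope.

(* [borel R n] is convertible to ['cV[R]_n]. *)
Definition borel (R : realType) (n : nat) := g_sigma_algebraType (@open 'cV[R]_n).

Definition dotv (R : realType) (n : nat) (v x : 'cV[R]_n) : R := (v^T *m x) 0 0.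

Definition posdef (R : realType) (n : nat) (S : 'M[R]_n) : Prop :=
  S^T = S /\ forall v : 'cV[R]_n, v != 0 -> 0 < dotv v (S *m v).

Definition possemidef (R : realType) (n : nat) (S : 'M[R]_n) : Prop :=
  S^T = S /\ forall v : 'cV[R]_n, 0 <= dotv v (S *m v).

Definition controllable (R : realType) (n m : nat) (A : 'M[R]_n) (B : 'M[R]_(n, m)) : Prop :=
  forall a b : 'cV[R]_n, exists (N : nat) (u : nat -> 'cV[R]_m) (x : nat -> 'cV[R]_n),
    [/\ x 0%N = a, x N = b & forall t, x t.+1 = A *m x t + B *m u t].

Definition observable (R : realType) (n p : nat) (A : 'M[R]_n) (C : 'M[R]_(p, n)) : Prop :=
  forall x y : nat -> 'cV[R]_n,
    (forall t, x t.+1 = A *m x t) -> (forall t, y t.+1 = A *m y t) ->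
    (forall t, C *m x t = C *m y t) -> x 0%N = y 0%N.

Section laws.
Context (R : realType) (n : nat).
Implicit Types (nu : {measure set (borel R n) -> \bar R}) (a : 'cV[R]_n) (S : 'M[R]_n).

Definition has_mean nu a : Prop := forall i : 'I_n,
  nu.-integrable [set: borel R n] (fun x : borel R n => ((x : 'cV[R]_n) i 0)%:E) /\
  (\int[nu]_(x in [set: borel R n]) (((x : 'cV[R]_n) i 0)%:E) = (a i 0)%:E)%E.

(* The covariance is taken about [a], which is meant to be the mean of [nu]. *)
Definition has_covariance nu a S : Prop := forall i j : 'I_n,
  let f := fun x : borel R n => let d := (x : 'cV[R]_n) - a in (d i 0 * d j 0)%:E in
  nu.-integrable [set: borel R n] f /\
  (\int[nu]_(x in [set: borel R n]) f x = (S i j)%:E)%E.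

(* Normal law on the line given by its mean and its variance; the library's
   [normal_prob] takes the standard deviation, and is not a Dirac mass when
   the latter is 0. *)
Definition normal_law (a v : R) (F : set (measurableTypeR R)) : \bar R :=
  if v == 0 then dirac a F else normal_prob a (Num.sqrt v) F.

(* Possibly degenerate Gaussian law: every linear functional is normal. *)
Definition gaussian_law nu a S : Prop :=
  possemidef S /\
  forall (v : 'cV[R]_n) (F : set (measurableTypeR R)), measurable F ->
    nu (@dotv R n v @^-1` F) = normal_law (dotv v a) (dotv v (S *m v)) F.

End laws.

Section closed_loop.
Context (R : realType) (n m : nat) (d : measure_display) (T : measurableType d).
Context (P : probability T R).
Implicit Types (x w : nat -> {RV P >-> borel R n}) (u : nat -> {RV P >-> borel R m}).

(* x_0, w_0, w_1, ... are mutually independent (a finite subfamily is obtained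
   by taking the remaining sets equal to the whole space). *)
Definition independent_init_noise (x0 : {RV P >-> borel R n}) w : Prop :=
  forall (N : nat) (E : set (borel R n)) (G : nat -> set (borel R n)),
    measurable E -> (forall t, measurable (G t)) ->
    (P ((x0 @^-1` E) `&` \bigcap_(t in `I_N) (w t @^-1` G t)) =
     P (x0 @^-1` E) * \prod_(t < N) P (w t @^-1` G t))%E.

(* The sigma-algebra of everything that u_t may not depend on except through
   x_t: states up to time t, inputs before time t, and the whole noise. *)
Definition before_input x u w (t : nat) : set (set T) :=
  <<s (\bigcup_(s in `I_t.+1) preimage_set_system [set: T] (x s) measurable)
      `|` (\bigcup_(s in `I_t) preimage_set_system [set: T] (u s) measurable)
      `|` (\bigcup_s preimage_set_system [set: T] (w s) measurable) >>.

(* The conditional law of u_t given [before_input x u w t] is [pi x_t]. *)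
Definition drawn_from (pi : R.-pker (borel R n) ~> (borel R m)) x u w : Prop :=
  forall (t : nat) (D : set T) (F : set (borel R m)),
    before_input x u w t D -> measurable F ->
    (P (D `&` (u t @^-1` F)) = \int[P]_(o in D) pi (x t o) F)%E.

(* (P, x, u) realizes the law of the states and inputs induced by the initial
   law [nu0], the policy [pi] and the dynamics; [x], [u] and [w] live on an
   arbitrary probability space, but the joint law of (x, u) is determined. *)
Definition closed_loop (A : 'M[R]_n) (B : 'M[R]_(n, m)) (W : 'M[R]_n)
    (nu0 : probability (borel R n) R) (pi : R.-pker (borel R n) ~> (borel R m))
    x u w : Prop :=
  [/\ forall E : set (borel R n), measurable E -> P (x 0%N @^-1` E) = nu0 E,
      independent_init_noise (x 0%N) w,
      forall t, gaussian_law (distribution P (w t)) 0 W,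
      drawn_from pi x u w
    & forall t o, (x t.+1 o : 'cV[R]_n) =
        A *m (x t o : 'cV[R]_n) + B *m (u t o : 'cV[R]_m) + (w t o : 'cV[R]_n)].

Definition occupation_measure (alpha : R) x u
    (mu : {measure set (borel R n * borel R m) -> \bar R}) : Prop :=
  forall (E : set (borel R n)) (F : set (borel R m)), measurable E -> measurable F ->
    (mu (E `*` F) =
     \sum_(0 <= t <oo) (alpha ^+ t)%:E * P ((x t @^-1` E) `&` (u t @^-1` F)))%E.

Definition chance_constraint (alpha : R) x (g : 'cV[R]_n) (h eps : R) : Prop :=
  ((1 - eps)%:E <=
   \sum_(0 <= t <oo) (alpha ^+ t)%:E * P [set o | (`|dotv g (x t o)| <= h)%R])%E.

End closed_loop.

Definition linear_policy (R : realType) (n m : nat)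
    (pi : R.-pker (borel R n) ~> (borel R m)) (K : 'M[R]_(m, n)) : Prop :=
  forall (x : borel R n) (F : set (borel R m)), measurable F ->
    pi x F = @dirac _ (borel R m) (K *m (x : 'cV[R]_n)) R F.

Section second_moments.
Context (R : realType) (n m : nat).
Variable mu : {measure set (borel R n * borel R m) -> \bar R}.

Definition finite_second_moments : Prop :=
  (\int[mu]_z (dotv (z.1 : 'cV[R]_n) z.1 + dotv (z.2 : 'cV[R]_m) z.2)%:E < +oo)%E.

Definition state_marginal : set (borel R n) -> \bar R :=
  pushforward mu (fst : borel R n * borel R m -> borel R n).

Fact state_marginal0 : state_marginal set0 = 0%E.
Proof. exact: measure0. Qed.

Fact state_marginal_ge0 E : (0 <= state_marginal E)%E.
Proof. exact: measure_ge0. Qed.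

Fact state_marginal_semi_sigma_additive : semi_sigma_additive state_marginal.
Proof. exact: measure_semi_sigma_additive. Qed.

HB.instance Definition _ := isMeasure.Build _ _ _ state_marginal
  state_marginal0 state_marginal_ge0 state_marginal_semi_sigma_additive.

Definition Zxx : 'M[R]_n := \matrix_(i, j)
  \int[state_marginal]_x ((x : 'cV[R]_n) i 0 * (x : 'cV[R]_n) j 0).

End second_moments.

Section error_function.
Context (R : realType).

Definition erf (z : R) : R :=
  2 / Num.sqrt pi *
  (if 0 <= z then \int[lebesgue_measure]_(s in `[0, z]) expR (- s ^+ 2)
   else - \int[lebesgue_measure]_(s in `[z, 0]) expR (- s ^+ 2)).

(* [erf] is a strictly increasing bijection from R to ]-1, 1[; the value
   outside ]-1, 1[ is the junk value 0. *)
Definition erf_inv (y : R) : R := xget 0 [set z | erf z = y].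

End error_function.

(* Main.v *)
(* By nonnegativity the t = 0 term of the discounted sum bounds it from below,
   so the law of x_0 is dominated by the state marginal M of the occupation
   measure. In particular M has mass at least 1, and (1) is Chebyshev's
   inequality for M. For (2), x_0 alone already meets the chance constraint:
   the variance of g^T x_0 is at most Tr(Q1 Zxx) <= beta1, and g^T x_0 is
   centred normal, so P(|g^T x_0| <= h) >= 1 - eps / mbar >= 1 - eps. *)
Require Import Defs.
From HB Require Import structures.
From mathcomp Require Import all_boot all_order all_algebra.
From mathcomp Require Import all_classical all_reals all_analysis measurable_realfun.
From mathcomp Require Import ring lra.

Set Implicit Arguments.
Unset Strict Implicit.
Unset Printing Implicit Defensive.

Import Order.TTheory GRing.Theory Num.Theory.
Import numFieldNormedType.Exports.
Import gauss_integral_proof.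

Local Open Scope classical_set_scope.
Local Open Scope ring_scope.

(** * Measurability and second moments of linear functionals *)

Lemma continuous_borel_measurable (R : realType) (n : nat) (f : 'cV[R]_n -> R) :
  continuous f ->
  measurable_fun [set: borel R n] (f : borel R n -> measurableTypeR R).
Proof.
move=> /continuousP cf.
apply: (measurability _ (RGenOpens.measurableE R)) => _ [_ [a [b ->]] <-].
rewrite setTI; apply: sub_sigma_algebra; apply: cf; exact: interval_open.
Qed.

Lemma measurable_coord (R : realType) (n : nat) (i : 'I_n) :
  measurable_fun [set: borel R n]
    ((fun x => (x : 'cV[R]_n) i 0) : borel R n -> measurableTypeR R).
Proof.
apply: (@continuous_borel_measurable R n (fun x => x i 0)).
exact: coord_continuous.
Qed.

Lemma dotvE (R : realType) (n : nat) (v y : 'cV[R]_n) :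
  dotv v y = \sum_i v i 0 * y i 0.
Proof. by rewrite /dotv mxE; apply: eq_bigr => i _; rewrite mxE. Qed.

Lemma measurable_dotv (R : realType) (n : nat) (v : 'cV[R]_n) :
  measurable_fun [set: borel R n] (dotv v : borel R n -> measurableTypeR R).
Proof.
rewrite (_ : dotv v = fun y => \sum_i v i 0 * (y : 'cV[R]_n) i 0); last first.
  by apply/funext => y; exact: dotvE.
apply: measurable_sum => i; apply: measurable_funM => //.
exact: measurable_coord.
Qed.

Lemma dotv_sqr (R : realType) (n : nat) (v y : 'cV[R]_n) :
  dotv v y ^+ 2 = \sum_i \sum_j v i 0 * v j 0 * (y i 0 * y j 0).
Proof.
rewrite expr2 dotvE big_distrlr/=; apply: eq_bigr => i _; apply: eq_bigr => j _.
by rewrite mulrACA.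
Qed.

(** Cyclicity of the trace reduces the left side to the trace of a 1 by 1 matrix. *)
Lemma mxtrace_rank1 (R : realType) (n : nat) (g : 'cV[R]_n) (S : 'M[R]_n) :
  \tr (g *m g^T *m S) = dotv g (S *m g).
Proof. by rewrite /dotv -mulmxA mxtrace_mulC -mulmxA [LHS]trace_mx11. Qed.

Lemma dotv_quad (R : realType) (n : nat) (g : 'cV[R]_n) (S : 'M[R]_n) :
  dotv g (S *m g) = \sum_i \sum_j g i 0 * g j 0 * S i j.
Proof.
rewrite dotvE; apply: eq_bigr => i _; rewrite mxE big_distrr/=.
by apply: eq_bigr => j _; rewrite -mulrA [S i j * _]mulrC.
Qed.

(** Expanding the square and using linearity leaves only the mixed moments. The measure need not
    have mass 1, so the lemma serves both for [nu0] with [S0] and for the state marginal with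
    [Zxx]. *)
Lemma integral_dotv_sqr (R : realType) (n : nat)
    (nu : {measure set (borel R n) -> \bar R}) (S : 'M[R]_n) (g : 'cV[R]_n) :
  (forall i j : 'I_n,
    let f := fun x : borel R n => ((x : 'cV[R]_n) i 0 * (x : 'cV[R]_n) j 0)%:E in
    nu.-integrable [set: borel R n] f /\
    (\int[nu]_(x in [set: borel R n]) f x = (S i j)%:E)%E) ->
  (\int[nu]_(x in [set: borel R n]) (dotv g (x : 'cV[R]_n) ^+ 2)%:E =
   (dotv g (S *m g))%:E)%E.
Proof.
move=> nuS; rewrite dotv_quad.
under eq_integral.
  move=> x _; rewrite dotv_sqr -sumEFin.
  under eq_bigr do rewrite -sumEFin.
  over.
have int_ij i j : nu.-integrable [set: borel R n] (fun x : borel R n =>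
    (g i 0 * g j 0 * ((x : 'cV[R]_n) i 0 * (x : 'cV[R]_n) j 0))%:E).
  under eq_fun do rewrite EFinM.
  by apply: integrableZl => //; have [] := nuS i j.
rewrite integral_sum//=; last by move=> i; exact: integrable_sum.
rewrite -sumEFin; apply: eq_bigr => i _.
rewrite integral_sum//= -sumEFin; apply: eq_bigr => j _.
under eq_integral do rewrite EFinM.
by have [inti eqi] := nuS i j; rewrite integralZl// eqi -EFinM.
Qed.

(** * The error function and centred normal probabilities *)

Lemma erf_ge0E (R : realType) (z : R) : 0 <= z ->
  erf z = 2 / Num.sqrt trigo.pi * integral0_gauss z.
Proof. by move=> z0; rewrite /erf z0. Qed.

Lemma erf_le0 (R : realType) (z : R) : z < 0 -> erf z <= 0.
Proof.
move=> z0; rewrite /erf (lt_geF z0) mulrN oppr_le0 mulr_ge0//.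
by apply: Rintegral_ge0 => // t _; exact: expR_ge0.
Qed.

Lemma integrable_gauss_fun (R : realType) (a b : R) :
  lebesgue_measure.-integrable `[a, b] (EFin \o @gauss_fun R).
Proof.
apply: continuous_compact_integrable; first exact: segment_compact.
by apply: continuous_subspaceT; exact: continuous_gauss_fun.
Qed.

Lemma integral_gauss_fun (R : realType) (z : R) :
  (\int[lebesgue_measure]_(t in `[0%R, z]) (gauss_fun t)%:E =
   (integral0_gauss z)%:E)%E.
Proof.
rewrite /integral0_gauss fineK//.
by apply: integrable_fin_num => //; exact: integrable_gauss_fun.
Qed.

(** The intervals are nested and the integrand is nonnegative; a negative endpoint gives an empty
    interval, hence the value 0. *)
Lemma le_integral0_gauss (R : realType) (a b : R) :
  a <= b -> integral0_gauss a <= integral0_gauss b.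
Proof.
move=> ab; rewrite -lee_fin -!integral_gauss_fun.
apply: ge0_subset_integral => //=.
- by apply/measurable_EFinP/measurable_funTS; exact: measurable_gauss_fun.
- by move=> x _; rewrite lee_fin gauss_fun_ge0.
- by move=> x/=; rewrite !in_itv/= => /andP[-> /le_trans->].
Qed.

Lemma le_erf (R : realType) (a b : R) : 0 <= a -> a <= b -> erf a <= erf b.
Proof.
move=> a0 ab; rewrite !erf_ge0E ?(le_trans a0)// ler_wpM2l//.
exact: le_integral0_gauss.
Qed.

(** Since [erf_inv] picks some preimage whenever there is one, it suffices that [erf] attains [y].
    This follows from the intermediate value theorem applied to [integral0_gauss]. *)
Lemma erf_invK (R : realType) (y : R) : 0 < y < 1 -> erf (erf_inv y) = y.
Proof.
move=> /andP[y0 y1].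
pose s := Num.sqrt (trigo.pi : R).
have s0 : 0 < s by rewrite sqrtr_gt0 pi_gt0.
(* The value that [integral0_gauss z] must take for [erf z] to equal [y]. *)
pose c := y * s / 2.
have c0 : 0 < c by rewrite !mulr_gt0.
(* The Gaussian integral is available as the limit pi / 4 of the square of [integral0_gauss], so the
   comparison is made between squares: c^2 = y^2 pi / 4 < pi / 4. *)
have [b b0 cb] : exists2 b, 0 <= b & c < integral0_gauss b.
  have := @cvg_integral0_gauss_sqr R.
  have clt : c ^+ 2 < trigo.pi / 4.
    rewrite /c !exprMn sqr_sqrtr ?pi_ge0// exprVn.
    rewrite (_ : 2 ^+ 2 = 4)//; last by rewrite -natrX.
    rewrite ltr_pM2r ?invr_gt0// gtr_pMl ?pi_gt0//.
    by rewrite expr_lt1 // ltW.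
  move=> /cvgr_gt/(_ _ clt) near_gt.
  have [b [b0 cb]] : exists b : R, 0 <= b /\ c ^+ 2 < integral0_gauss b ^+ 2.
    near +oo_R => b; exists b; split; near: b.
      by apply: nbhs_pinfty_ge.
    exact: near_gt.
  exists b => //; rewrite -(@ltr_pXn2r _ 2)// ?nnegrE ?integral0_gauss_ge0//.
  exact: ltW.
have cI : {within `[0, b], continuous (@integral0_gauss R)}.
  by apply: parameterized_integral_continuous => //; exact: integrable_gauss_fun.
have I0 : integral0_gauss (0 : R) = 0.
  by rewrite /integral0_gauss set_itv1 Rintegral_set1.
have [|z zb Iz] := @IVT R (@integral0_gauss R) 0 b c b0 cI.
  by rewrite I0 min_l ?max_r ?integral0_gauss_ge0// (ltW c0) (ltW cb).
apply: (@xgetPex _ 0 [set z | erf z = y]); exists z => /=.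
move: zb; rewrite in_itv/= => /andP[z0 _].
rewrite erf_ge0E// Iz /c -/s mulrCA; field.
by rewrite gt_eqF.
Unshelve. all: by end_near. Qed.

(** At a negative point [erf] is at most 0, so it cannot take the positive value [y] there. *)
Lemma erf_inv_ge0 (R : realType) (y : R) : 0 < y < 1 -> 0 <= erf_inv y.
Proof.
move=> y01; rewrite leNgt; apply/negP => /erf_le0.
by rewrite erf_invK// leNgt; case/andP : y01 => ->.
Qed.

(** The interval is cut at 0, and the reflection t -> -t carries the negative half onto the positive
    one because [gauss_fun] is even. *)
Lemma integral_gauss_fun_sym (R : realType) (a : R) : 0 <= a ->
  (\int[lebesgue_measure]_(t in `[(- a)%R, a]) (gauss_fun t)%:E =
   (2 * integral0_gauss a)%:E)%E.
Proof.
move=> a0.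
have mg D : measurable_fun D (fun t : R => (gauss_fun t)%:E).
  by apply/measurable_EFinP/measurable_funTS; exact: measurable_gauss_fun.
have a0' : - a <= 0 by rewrite oppr_le0.
rewrite (@itv_bndbnd_setU _ _ _ (BLeft 0)) ?bnd_simp//.
rewrite ge0_integral_setU//=; first last.
- apply/disj_set2P/seteqP; split => // x /=; rewrite !in_itv/=.
  by move=> -[] /andP[_ x0] /andP[]; rewrite leNgt x0.
- by move=> x _; rewrite lee_fin gauss_fun_ge0.
- exact: mg.
(* The right endpoint 0 is written as -0 to give the interval the shape needed by the reflection
   rule. *)
rewrite integral_itv_bndo_bndc// -{1}(@oppr0 R).
rewrite integration_by_substitution_oppr//; last first.
  by apply: continuous_subspaceT; exact: continuous_gauss_fun.
under eq_integral do rewrite /= /gauss_fun sqrrN.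
by rewrite -/(gauss_fun _) !integral_gauss_fun -EFinD mulr_natl mulr2n.
Qed.

(** The substitution t = k x, with k = 1 / (s sqrt 2), turns the centred normal density of standard
    deviation [s] into exp(-t^2) / sqrt pi. *)
Lemma normal_prob_itv (R : realType) (s h : R) : 0 < s -> 0 <= h ->
  normal_prob 0 s `[- h, h] = (erf (h / (s * Num.sqrt 2)))%:E.
Proof.
move=> s0 h0; pose k := (s * Num.sqrt 2)^-1.
have k0 : 0 < k by rewrite invr_gt0 mulr_gt0// sqrtr_gt0.
have k2 : k ^+ 2 = (s ^+ 2 *+ 2)^-1.
  by rewrite /k exprVn exprMn sqr_sqrtr// mulr_natr.
pose F (x : R) := x * k.
have dF (x : R) : is_derive x 1 F k.
  rewrite /F; apply: is_derive_eq; rewrite scaler0 add0r /GRing.scale/=.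
  by rewrite mulr1.
have F'E : derive1 F = cst k by apply/funext => x; rewrite derive1E derive_val.
have hN : - h <= h by rewrite ge0_cp.
have pk : normal_peak s = k / Num.sqrt trigo.pi.
  rewrite /normal_peak /k -mulrnAr -(mulr_natr trigo.pi).
  rewrite sqrtrM ?sqr_ge0// sqrtr_sqr (gtr0_norm s0) sqrtrM ?pi_ge0// -invfM.
  by congr (_^-1); rewrite mulrAC mulrA.
have cF : continuous F by move=> x; apply: cvgMr_tmp; exact: cvg_id.
have FN : F (- h) = - F h by rewrite /F mulNr.
have subst : (\int[lebesgue_measure]_(x in `[(- h)%R, h]) (gauss_fun (F x) * k)%:E =
    (2 * integral0_gauss (F h))%:E)%E.
  rewrite -integral_gauss_fun_sym; last by rewrite mulr_ge0// ltW.
  rewrite -FN (@integration_by_substitution_increasing R F) ?F'E//.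
  - by move=> x y _ _ xy; rewrite /F ltr_pM2r.
  - by move=> x _; exact: cst_continuous.
  - exact: is_cvg_cst.
  - exact: is_cvg_cst.
  - split; first by [].
      exact: cvg_at_right_filter (cF _).
    exact: cvg_at_left_filter (cF _).
  - by apply: continuous_subspaceT; exact: continuous_gauss_fun.
rewrite /normal_prob erf_ge0E ?mulr_ge0// ?ltW// -/(F h).
rewrite mulrAC mulrC EFinM -subst -integralZl//=; last first.
  apply: (@continuous_compact_integrable _ (fun x => gauss_fun (F x) * k)).
    exact: segment_compact.
  apply: continuous_subspaceT => x; apply: cvgMr_tmp.
  by apply: continuous_comp; [exact: cF|exact: continuous_gauss_fun].
apply: eq_integral => x _; rewrite -EFinM normal_pdfE ?gt_eqF// pk.
rewrite /normal_fun subr0 /gauss_fun /F exprMn k2 mulNr.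
congr EFin; ring.
Qed.

(** * Bounds on the slab where the functional is at most [h] in absolute value *)

Lemma norm_dotv_leE (R : realType) (n : nat) (g : 'cV[R]_n) (h : R) :
  [set y | `|dotv g y| <= h] = dotv g @^-1` `[- h, h].
Proof. by apply/seteqP; split => y /=; rewrite in_itv/= ler_norml. Qed.

Lemma measurable_norm_dotv_le (R : realType) (n : nat) (g : 'cV[R]_n) (h : R) :
  measurable ([set y | `|dotv g y| <= h] : set (borel R n)).
Proof.
rewrite norm_dotv_leE.
by rewrite -[X in measurable X]setTI; apply: measurable_dotv.
Qed.

Lemma setC_norm_dotv_le (R : realType) (n : nat) (g : 'cV[R]_n) (h : R) :
  ~` [set y | `|dotv g y| <= h] = [set y | h < `|dotv g y|].
Proof. by apply/seteqP; split => y /=; rewrite ltNge => /negP. Qed.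

(** Chebyshev's inequality for an arbitrary measure: Markov's inequality for the squared functional
    at level h^2. *)
Lemma tail_le_second_moment (R : realType) (n : nat)
    (nu : {measure set (borel R n) -> \bar R}) (g : 'cV[R]_n) (h : R) : 0 < h ->
  ((h ^+ 2)%:E * nu [set y | (h < `|dotv g y|)%R] <=
   \int[nu]_(y in [set: borel R n]) (dotv g (y : 'cV[R]_n) ^+ 2)%:E)%E.
Proof.
move=> h0.
have mg2 : measurable_fun [set: borel R n]
    (fun y : borel R n => (dotv g (y : 'cV[R]_n) ^+ 2)%:E).
  apply/measurable_EFinP; apply: measurable_funX; exact: measurable_dotv.
have := @le_integral_abse _ _ R nu _ measurableT _ (h ^+ 2) mg2.
rewrite exprn_gt0// => /(_ isT) /=.
rewrite (_ : (fun x : borel R n => _) =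
    (fun y : borel R n => (dotv g (y : 'cV[R]_n) ^+ 2)%:E)); last first.
  by apply/funext => y; rewrite ger0_norm// sqr_ge0.
apply: le_trans; rewrite lee_pmul2l// ?lte_fin ?exprn_gt0//.
(* Markov's inequality concerns the non-strict set h^2 <= (g^T y)^2, which contains the strict
   tail. *)
apply: le_measure; rewrite ?inE.
- by rewrite -setC_norm_dotv_le; apply: measurableC; exact: measurable_norm_dotv_le.
- apply: emeasurable_fun_c_infty => //.
  apply/measurable_EFinP; apply: measurableT_comp => //.
  by apply: measurable_funX; exact: measurable_dotv.
- move=> y /= hy; split => //=; rewrite lee_fin ger0_norm ?sqr_ge0//.
  by rewrite -(real_normK (num_real (dotv g y))) ler_pXn2r ?nnegrE ?(ltW h0)// ltW.
Qed.

(** With z = [erf_inv y], the bound on [v] gives z <= h / sqrt (2 v), and monotonicity of [erf]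
    gives the claim. For v = 0 the law is the Dirac mass at 0, which lies in the interval. *)
Lemma normal_law_itv_ge (R : realType) (v h y : R) : 0 < h -> 0 < y < 1 -> 0 <= v ->
  v <= h ^+ 2 / (2 * erf_inv y ^+ 2) -> (y%:E <= normal_law 0 v `[(- h)%R, h])%E.
Proof.
move=> h0 y01 v0 vle; rewrite /normal_law; case: ifPn => [_|vn0].
  rewrite diracE mem_set/=; first by rewrite lee_fin ltW//; case/andP: y01.
  by rewrite in_itv/= oppr_le0 ltW.
have v_gt0 : 0 < v by rewrite lt_neqAle eq_sym vn0.
rewrite normal_prob_itv ?sqrtr_gt0 ?(ltW h0)// lee_fin -{1}(erf_invK y01).
have z0 := erf_inv_ge0 y01.
apply: le_erf => //; rewrite ler_pdivlMr ?mulr_gt0 ?sqrtr_gt0//.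
(* If [erf_inv y] were 0, the bound on [v] would involve a division by 0; the inequality to prove
   then reads 0 <= h. *)
move: z0; rewrite le_eqVlt => /predU1P[<-|z0]; first by rewrite mul0r ltW.
rewrite -(@ler_pXn2r _ 2)// ?nnegrE ?(ltW h0)// ?mulr_ge0 ?(ltW z0)//.
rewrite !exprMn !sqr_sqrtr//.
move: vle; rewrite ler_pdivlMr ?mulr_gt0 ?exprn_gt0//.
by congr (_ <= _); ring.
Qed.

(** * The state marginal of the occupation measure and its second moments *)

Lemma dotv_self_ge0 (R : realType) (n : nat) (y : 'cV[R]_n) : 0 <= dotv y y.
Proof. by rewrite dotvE sumr_ge0// => i _; rewrite -expr2 sqr_ge0. Qed.

Lemma measurable_dotv_self (R : realType) (n : nat) :
  measurable_fun [set: borel R n]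
    ((fun y => dotv (y : 'cV[R]_n) y) : borel R n -> measurableTypeR R).
Proof.
under eq_fun do rewrite dotvE.
apply: measurable_sum => i; apply: measurable_funM; exact: measurable_coord.
Qed.

(** Each squared coordinate is at most |y|^2, and 2 |a b| <= a^2 + b^2. This is the domination that
    makes the mixed moments integrable. *)
Lemma normM_coord_le (R : realType) (n : nat) (y : 'cV[R]_n) (i j : 'I_n) :
  `|y i 0 * y j 0| <= dotv y y.
Proof.
have sqr_le k : y k 0 ^+ 2 <= dotv y y.
  rewrite dotvE (bigD1 k)//= expr2 lerDl sumr_ge0// => l _.
  by rewrite -expr2 sqr_ge0.
have := sqr_le i; have := sqr_le j.
have := sqr_ge0 (`|y i 0| - `|y j 0|).
rewrite normrM -(real_normK (num_real (y i 0))) -(real_normK (num_real (y j 0))).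
nra.
Qed.

Section occupation.
Context (R : realType) (n m : nat) (d : measure_display) (T : measurableType d).
Context (P : probability T R).
Context (x : nat -> {RV P >-> borel R n}) (u : nat -> {RV P >-> borel R m}).
Context (mu : {measure set (borel R n * borel R m) -> \bar R}) (alpha : R).
Hypothesis halpha : 0 < alpha < 1.
Hypothesis hmu : occupation_measure alpha x u mu.

Lemma state_marginalE (E : set (borel R n)) : measurable E ->
  (state_marginal mu E = \sum_(0 <= t <oo) (alpha ^+ t)%:E * P (x t @^-1` E))%E.
Proof.
move=> mE; rewrite /state_marginal /pushforward.
rewrite (_ : _ @^-1` E = E `*` setT); last by apply/seteqP; split => -[a b]//= [].
rewrite hmu//; apply: eq_eseriesr => t _.
by rewrite preimage_setT setIT.
Qed.

Lemma init_le_state_marginal (E : set (borel R n)) : measurable E ->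
  (P (x 0%N @^-1` E) <= state_marginal mu E)%E.
Proof.
move=> mE; rewrite state_marginalE//.
(* The partial sum below index 1 is the single term t = 0, whose weight is 1. *)
rewrite (le_trans _ (nneseries_lim_ge 1 _)) ?big_nat1 ?mul1e//.
move=> t _ _; rewrite mule_ge0// lee_fin exprn_ge0//.
by case/andP : halpha => /ltW.
Qed.

Lemma chance_constraintE (g : 'cV[R]_n) (h eps : R) :
  chance_constraint alpha x g h eps <->
  ((1 - eps)%:E <= state_marginal mu [set y | (`|dotv g y| <= h)%R])%E.
Proof.
rewrite /chance_constraint state_marginalE//; exact: measurable_norm_dotv_le.
Qed.

Hypothesis hmu2 : finite_second_moments mu.

(** [Zxx] is a matrix of real-valued integrals, which would default to 0 on an infinite value.
    Integrability, obtained from the finite second moments of [mu], excludes this. *)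
Lemma state_marginal_moment (i j : 'I_n) :
  let f := fun y : borel R n => ((y : 'cV[R]_n) i 0 * (y : 'cV[R]_n) j 0)%:E in
  (state_marginal mu).-integrable [set: borel R n] f /\
  (\int[state_marginal mu]_(y in [set: borel R n]) f y = (Zxx mu i j)%:E)%E.
Proof.
move=> f.
have mf : measurable_fun [set: borel R n] f.
  by apply/measurable_EFinP; apply: measurable_funM; exact: measurable_coord.
suff intf : (state_marginal mu).-integrable [set: borel R n] f.
  split => //; rewrite mxE /Rintegral fineK//.
  exact: (integrable_fin_num _ intf).
(* Integrability is transferred to the product space, where |x|^2 + |u|^2 dominates. *)
apply: (@integrable_pushforward _ _ _ _ R fst measurable_fst mu setT f mf) => //.
rewrite preimage_setT.
pose q (z : borel R n * borel R m) : R :=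
  dotv (z.1 : 'cV[R]_n) z.1 + dotv (z.2 : 'cV[R]_m) z.2.
have q0 z : 0 <= q z by rewrite addr_ge0// dotv_self_ge0.
have intq : mu.-integrable setT (EFin \o q).
  apply/integrableP; split.
    apply/measurable_EFinP; apply: measurable_funD.
      apply: (measurableT_comp
        (f := fun y : borel R n => dotv (y : 'cV[R]_n) y)) => //.
      exact: measurable_dotv_self.
    apply: (measurableT_comp
      (f := fun y : borel R m => dotv (y : 'cV[R]_m) y)) => //.
    exact: measurable_dotv_self.
  by under eq_integral do rewrite /= ger0_norm//.
apply: le_integrable intq => //; first exact: measurableT_comp.
move=> [y v] _; rewrite lee_fin /= (ger0_norm (q0 _)).
by rewrite (le_trans (normM_coord_le _ _ _))// lerDl dotv_self_ge0.
Qed.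

Lemma integral_state_marginal (g : 'cV[R]_n) :
  (\int[state_marginal mu]_(y in [set: borel R n]) (dotv g (y : 'cV[R]_n) ^+ 2)%:E =
   (\tr (g *m g^T *m Zxx mu))%:E)%E.
Proof.
by rewrite mxtrace_rank1; apply: integral_dotv_sqr; exact: state_marginal_moment.
Qed.

End occupation.

(** * Derivation of the two sufficient conditions *)

Theorem proposition4 (R : realType) (n m p : nat)
  (A : 'M[R]_n) (B : 'M[R]_(n, m)) (C : 'M[R]_(p, n))
  (Q0 : 'M[R]_n) (R0 : 'M[R]_m) (W S0 : 'M[R]_n) (alpha : R)
  (nu0 : probability (borel R n) R)
  (pi : R.-pker (borel R n) ~> (borel R m))
  (d : measure_display) (T : measurableType d) (P : probability T R)
  (x : nat -> {RV P >-> borel R n}) (u : nat -> {RV P >-> borel R m})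
  (w : nat -> {RV P >-> borel R n})
  (mu : {measure set (borel R n * borel R m) -> \bar R})
  (g : 'cV[R]_n) (h eps : R)
  (hQ0 : Q0 = C^T *m C) (hR0 : posdef R0)
  (hAB : controllable A B) (hAC : observable A C)
  (halpha : 0 < alpha < 1)
  (hmean : has_mean nu0 0) (hcov : has_covariance nu0 0 S0)
  (hloop : closed_loop A B W nu0 pi x u w)
  (hmu : occupation_measure alpha x u mu)
  (hmu2 : finite_second_moments mu)
  (hh : 0 < h) (heps : 0 < eps < 1) :
  let Q1 := g *m g^T in
  let mbar := 1 / (1 - alpha) in
  (let beta1 := eps * h ^+ 2 in
   \tr (Q1 *m Zxx mu) <= beta1 -> chance_constraint alpha x g h eps)
  /\
  (forall K : 'M[R]_(m, n), linear_policy pi K -> gaussian_law nu0 0 S0 ->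
   let beta1 := h ^+ 2 / (2 * (erf_inv (1 - eps / mbar)) ^+ 2) in
   \tr (Q1 *m Zxx mu) <= beta1 -> chance_constraint alpha x g h eps).
Proof.
case: hloop => law_x0 _ _ _ _.
have mA : measurable ([set y | `|dotv g y| <= h] : set (borel R n)).
  exact: measurable_norm_dotv_le.
move=> Q1 mbar; split=> [beta1|K _ gauss0 beta1] trle;
  apply/(chance_constraintE hmu).
- set D := [set y | _] in mA *.
  have tail_le : (state_marginal mu (~` D) <= eps%:E)%E.
    rewrite -(@lee_pmul2l _ (h ^+ 2)%:E)// ?lte_fin ?exprn_gt0//.
    rewrite setC_norm_dotv_le (le_trans (tail_le_second_moment _ _ hh))//.
    by rewrite (integral_state_marginal hmu2) -EFinM lee_fin mulrC.
  (* It remains to see that 1 <= M(D) + eps, which follows by splitting the total mass of the state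
     marginal M, at least 1, into D and its complement. *)
  rewrite EFinB leeBlDr//.
  have := init_le_state_marginal halpha hmu measurableT.
  rewrite preimage_setT probability_setT => /le_trans; apply.
  rewrite -(setvU D) setUC measureU ?setICr//; last exact: measurableC.
  by rewrite leeD2l.
- case: gauss0 => -[_ S0_ge0] nu0_normal.
  have halpha' := halpha; have heps' := heps.
  case/andP: halpha' => alpha0 alpha1; case/andP: heps' => eps0 eps1.
  have ebar : eps / mbar = eps * (1 - alpha) by rewrite /mbar div1r invrK.
  (* The argument of [erf_inv] lies where it is a true inverse of [erf]. *)
  have y01 : 0 < 1 - eps / mbar < 1 by rewrite ebar; apply/andP; split; nra.
  have vle : dotv g (S0 *m g) <= beta1.
    rewrite (le_trans _ trle)// -lee_fin -(integral_state_marginal hmu2).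
    (* As the mean is 0, the covariance entries are the raw second moments. *)
    rewrite -(@integral_dotv_sqr _ _ nu0 S0); last first.
      move=> i j; have := hcov i j => /=.
      by under eq_fun do rewrite subr0.
    apply: ge0_le_measure_integral => //.
    + move=> E mE; have := init_le_state_marginal halpha hmu mE.
      by rewrite law_x0.
    + by move=> y; rewrite lee_fin sqr_ge0.
    + apply/measurable_EFinP; apply: measurable_funX; exact: measurable_dotv.
  apply: le_trans (init_le_state_marginal halpha hmu mA).
  rewrite law_x0// norm_dotv_leE nu0_normal// /dotv mulmx0 mxE -/(dotv _ _).
  apply: le_trans (normal_law_itv_ge hh y01 (S0_ge0 g) vle).
  (* The slack comes from eps (1 - alpha) <= eps. *)
  by rewrite lee_fin ebar; nra.
Qed.
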